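(* Let $Y$ be a strictly positive random variable with finite second moment. Then $Y$ is exponentially distributed if and only if $$\ddot Y\overset{d}{=}\dot Y+U\cdot\dot Y',$$ where $\dot Y$ and $\dot Y'$ are both $Y$-transforms of $Y$, $\ddot Y$ is a $Y^2$-transform of $Y$, $U$ is a uniform random variable on $[0,1]$, and $\dot Y$, $\dot Y'$, $\ddot Y$ and $U$ are independent.
   Context: Size-biased transform: let $X$ be a random variable and $h$ a Borel function with $P(h(X)\ge 0)=1$ and $E[h(X)]\in(0,\infty)$. A random variable $W$ is an $h(X)$-transform of $X$ if $E[f(W)]=E[h(X)f(X)]/E[h(X)]$ for every positive Borel function $f$. In particular, a $Y$-transform corresponds to $h(y)=y$ and a $Y^2$-transform to $h(y)=y^2$. The notation $\overset{d}{=}$ means equality in distribution. ''Exponentially distributed'' means exponential with some mean in $(0,\infty)$. *)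

(* Defs.v *)
From HB Require Import structures.
From mathcomp Require Import all_boot all_order all_algebra.
From mathcomp Require Import all_classical all_reals all_analysis.
Import Order.TTheory GRing.Theory Num.Theory.
Import numFieldNormedType.Exports.

Set Implicit Arguments.
Unset Strict Implicit.
Unset Printing Implicit Defensive.

Local Open Scope classical_set_scope.
Local Open Scope ring_scope.
Local Open Scope ereal_scope.

Definition is_transform {R : realType} {d d' : measure_display}
    {T : measurableType d} {T' : measurableType d'}
    (P : probability T R) (Q : probability T' R) (h : R -> R)
    (X : {RV P >-> R}) (W : {RV Q >-> R}) : Prop :=
  [/\ measurable_fun [set: R] h,
      P [set w | (0 <= h (X w))%R] = 1,
      0 < 'E_P[h \o X] < +oo &
      forall f : R -> R, measurable_fun [set: R] f ->
        (forall x, (0 <= f x)%R) ->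
        'E_Q[f \o W] = 'E_P[(h \o X) \* (f \o X)] / 'E_P[h \o X]].

(* Laws are compared on measurable sets only, since the value of a measure on a
   non-measurable set is unconstrained. The random variables are taken as plain
   functions so that pointwise combinations such as [X \+ Y] can be used. *)
Definition has_law {R : realType} {d : measure_display} {T : measurableType d}
    (P : probability T R) (X : T -> R) (mu : set R -> \bar R) : Prop :=
  forall B : set R, measurable B -> pushforward P X B = mu B.

Definition eq_in_distribution {R : realType} {d d' : measure_display}
    {T : measurableType d} {T' : measurableType d'}
    (P : probability T R) (X : T -> R)
    (Q : probability T' R) (Y : T' -> R) : Prop :=
  has_law P X (pushforward Q Y).

(* [exponential_prob] is parametrized by the rate, the inverse of the mean m. *)
Definition exponentially_distributed {R : realType} {d : measure_display}
    {T : measurableType d} (P : probability T R) (X : {RV P >-> R}) : Prop :=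
  exists2 m : R, (0 < m)%R & has_law P X (exponential_prob m^-1).

Definition uniform01 {R : realType} {d : measure_display}
    {T : measurableType d} (P : probability T R) (X : {RV P >-> R}) : Prop :=
  has_law P X (uniform_prob (@ltr01 R)).

Definition mutually_independent {R : realType} {d : measure_display}
    {T : measurableType d} (P : probability T R) (I : finType)
    (X : I -> {RV P >-> R}) : Prop :=
  forall (J : {set I}) (B : I -> set R), (forall i, measurable (B i)) ->
    P (\bigcap_(i in [set` J]) (X i @^-1` B i)) =
    \prod_(i in J) P (X i @^-1` B i).

(* Main.v *)
From HB Require Import structures.
Require Import Defs.
From mathcomp Require Import all_boot all_order all_algebra.
From mathcomp Require Import all_classical all_reals all_analysis.
From mathcomp Require Import measurable_realfun ring lra.

(** Write phi for the Laplace transform of Y, m for its mean and M for its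
second moment.  A Y^k-transform of Y has Laplace transform proportional to
E[Y^k exp(-sY)], which is the k-th derivative of phi up to sign
([laplace_transform], [laplace_derive]); and biasing by y is exactly what
compensates the factor 1/y in E[exp(-sUy)] = (1 - exp(-sy)) / (sy), so that
U * Yd' has Laplace transform (1 - phi(s)) / (sm)
([uniform_product_laplace]).  By independence the two sides of the identity in
distribution have Laplace transforms
  phi''(s) / M   and   - phi'(s) / m * (1 - phi(s)) / (sm),
and since the Laplace transform determines a law on the positive half-line
([laplace_unique]), the identity in distribution is equivalent to the
differential equation s phi'' = - (M / m^2) phi' (1 - phi) on s > 0.

If Y is exponential with rate K then phi(s) = K / (K + s), the moments are
recovered by letting s decrease to 0 in its derivatives, and the equation is
checked by algebra.  Conversely the equation can be integrated twice
([laplace_ode]): in terms of g = 1 - phi it says that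
g - s g' - (c/2) g^2 has zero derivative, where c = M / m^2, and this constant
vanishes by letting s tend to 0; then s / g - (c/2) s has zero derivative,
hence equals some constant K.  Finally Y > 0 forces g to tend to 1 at infinity,
so c = 2 and g(s) = s / (K + s): phi is the Laplace transform of the
exponential law with rate K.

Laplace transforms determine laws because, for n large, the function
(1 - exp(-nax))^(n 2^n) with a = ln 2 / t is close to the indicator of x > t
([cutoff_cvg]), while its integral is a combination of values of the Laplace
transform. *)

Import Order.TTheory GRing.Theory Num.Theory.
Import numFieldNormedType.Exports.
Set Implicit Arguments.
Unset Strict Implicit.
Unset Printing Implicit Defensive.
Local Open Scope classical_set_scope.
Local Open Scope ring_scope.

(** * Laplace transforms on the positive half-line *)

(** Up to the sign (-1)^k this is the k-th derivative of the Laplace transform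
of [mu]; keeping the power as a parameter makes differentiation in [s] a shift
of [k].  The integral is restricted to the positive half-line, on which the
integrand is nonnegative and, for [s >= 0], at most [x ^+ k]. *)
Definition laplace (R : realType) (mu : probability R R) (k : nat)
    (s : R) : R :=
  \int[mu]_(x in `]0%R, +oo[) (x ^+ k * expR (- (s * x))).

Definition moment_finite (R : realType) (mu : probability R R) (k : nat) :=
  mu.-integrable `]0%R, +oo[ (fun x => (x ^+ k)%:E).

Lemma measurable_expR_scaled (R : realType) (s : R) (D : set R) :
  measurable_fun D (fun x : R => expR (- (s * x))).
Proof.
apply: measurable_funTS.
by apply: measurableT_comp => //; apply: measurableT_comp.
Qed.

Lemma measurable_EFin_expR_scaled (R : realType) (s : R) (D : set R) :
  measurable_fun D (fun x : R => (expR (- (s * x)))%:E).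
Proof. by apply/measurable_EFinP; exact: measurable_expR_scaled. Qed.

Section laplace_lemmas.
Context {R : realType} (mu : probability R R).

Lemma laplace_kernel_measurable (k : nat) (s : R) (D : set R) :
  measurable_fun D (fun x : R => x ^+ k * expR (- (s * x))).
Proof.
apply: measurable_funTS; apply: measurable_funM; first exact: exprn_measurable.
exact: measurable_expR_scaled.
Qed.

Lemma laplace_kernel_ge0 (k : nat) (s x : R) : x \in `]0%R, +oo[ ->
  0 <= x ^+ k * expR (- (s * x)).
Proof.
by rewrite in_itv/= andbT => x0; rewrite mulr_ge0 ?expR_ge0// exprn_ge0// ltW.
Qed.

Lemma laplace_kernel_le (k : nat) (s x : R) : 0 <= s -> x \in `]0%R, +oo[ ->
  x ^+ k * expR (- (s * x)) <= x ^+ k.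
Proof.
rewrite in_itv/= andbT => s0 x0.
by apply: ler_piMr; rewrite ?exprn_ge0 ?expR_le1 ?oppr_le0 ?mulr_ge0// ltW.
Qed.

Lemma laplace_kernel_integrable (k : nat) (s : R) :
  moment_finite mu k -> 0 <= s ->
  mu.-integrable `]0%R, +oo[ (EFin \o (fun x => x ^+ k * expR (- (s * x)))).
Proof.
move=> ik s0; apply: le_integrable ik => //.
  by apply/measurable_EFinP; exact: laplace_kernel_measurable.
move=> x x0 /=; rewrite lee_fin ger0_norm ?laplace_kernel_ge0//.
by rewrite (le_trans (laplace_kernel_le k s0 x0))// ler_norm.
Qed.

Lemma moment_finite0 : moment_finite mu 0.
Proof.
apply: (eq_integrable _ (EFin \o cst 1)) => //.
by apply: finite_measure_integrable_cst.
Qed.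

Lemma EFin_laplace (k : nat) (s : R) : moment_finite mu k -> 0 <= s ->
  (laplace mu k s)%:E =
  (\int[mu]_(x in `]0%R, +oo[) (x ^+ k * expR (- (s * x)))%:E)%E.
Proof.
move=> ik s0; rewrite /laplace /Rintegral fineK//.
by apply: integrable_fin_num => //; exact: laplace_kernel_integrable.
Qed.

Lemma laplace_ge0 (k : nat) (s : R) : 0 <= laplace mu k s.
Proof. by apply: Rintegral_ge0 => x x0; exact: laplace_kernel_ge0. Qed.

(** Differentiation under the integral sign: for nonnegative parameters the
derivative of the integrand is dominated by [x ^+ k.+1]. *)
Lemma laplace_derive (k : nat) (s : R) :
  moment_finite mu k -> moment_finite mu k.+1 -> 0 < s ->
  is_derive s 1 (laplace mu k) (- laplace mu k.+1 s).
Proof.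
move=> ik ik1 s0.
have dker (t x : R) : is_derive t 1 (fun t : R => x ^+ k * expR (- (t * x)))
    (- (x ^+ k.+1 * expR (- (t * x)))).
  apply: is_derive_eq; rewrite /GRing.scale/= exprS.
  by ring.
have Is : `]0, s + 1[%classic s by rewrite /= in_itv/= s0 ltrDl ltr01.
have sI (t : R) : `]0, s + 1[%classic t -> 0 <= t.
  by rewrite /= in_itv/= => /andP[/ltW].
have d1 (t x : R) : partial1of2 (fun t x : R => x ^+ k * expR (- (t * x))) t x =
    - (x ^+ k.+1 * expR (- (t * x))).
  by rewrite partial1of2E; apply: derive_val.
pose G (x : R) := `|x| ^+ k.+1.
have iG : mu.-integrable `]0%R, +oo[ (EFin \o G).
  apply: eq_integrable ik1 => // x; rewrite inE/= in_itv/= andbT => x0.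
  by rewrite /G ger0_norm// ltW.
have H1 : forall t : R, `]0, s + 1[%classic t -> mu.-integrable `]0%R, +oo[
    (EFin \o (fun x => x ^+ k * expR (- (t * x)))).
  by move=> t /sI; exact: laplace_kernel_integrable.
have H2 (t x : R) : `]0, s + 1[%classic t -> `]0%R, +oo[%classic x ->
    derivable (fun t : R => x ^+ k * expR (- (t * x))) t 1.
  by move=> _ _; apply: ex_derive.
have G0 x : 0 <= G x by rewrite exprn_ge0.
have H3 (t x : R) : `]0, s + 1[%classic t -> `]0%R, +oo[%classic x ->
    `|partial1of2 (fun t x : R => x ^+ k * expR (- (t * x))) t x| <= G x.
  move=> /sI t0 x0; rewrite d1 normrN ger0_norm ?laplace_kernel_ge0//.
  rewrite (le_trans (laplace_kernel_le k.+1 t0 x0))//.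
  by rewrite /G ger0_norm// ltW//; move: x0; rewrite /= in_itv/= andbT.
have mD : measurable (`]0%R, +oo[%classic : set R) by [].
apply: DeriveDef.
  exact: (derivable_under_integral mD Is H1 H2 G0 iG H3).
rewrite -derive1E (differentiation_under_integral mD Is H1 H2 G0 iG H3).
under eq_Rintegral do rewrite d1 -mulN1r.
rewrite RintegralZl ?mulN1r//.
by apply: laplace_kernel_integrable => //; exact: ltW.
Qed.

(** Dominated convergence, with [x ^+ k] as a bound. *)
Lemma laplace_cvg0 (k : nat) : moment_finite mu k ->
  laplace mu k s @[s --> 0^'+] --> laplace mu k 0.
Proof.
move=> ik.
(* The absolute value extends the transform to an open interval around 0, as
   the theorem on continuity under the integral sign requires. *)
pose F (s : R) := laplace mu k `|s|.
have : {for 0, continuous F}.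
  have mD : measurable (`]0%R, +oo[%classic : set R) by [].
  apply: (@continuity_under_integral _ _ _ mu
    (fun s x => x ^+ k * expR (- (`|s| * x))) _ mD (-1) 1 _ _
    (fun x => x ^+ k)).
  - by move=> t _; exact: laplace_kernel_integrable.
  - apply: aeW => x _ t _ /=; apply: cvgMr.
    apply: continuous_comp; last exact: continuous_expR.
    by apply: cvgN; apply: cvgMl; exact: norm_continuous.
  - exact: ik.
  - move=> t _; apply: aeW => x x0.
    by rewrite ger0_norm ?laplace_kernel_ge0// laplace_kernel_le.
  - by rewrite inE/= in_itv/= ltrN10 ltr01.
move=> /cvg_at_right_filter; rewrite /F normr0; apply: cvg_trans.
apply: near_eq_cvg; near=> s.
by rewrite /F gtr0_norm.
Unshelve. all: end_near. Qed.

Hypothesis mu_pos : mu `]0%R, +oo[%classic = 1%E.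

Lemma laplace00 : laplace mu 0 0 = 1.
Proof.
rewrite /laplace.
under eq_Rintegral do rewrite mul0r oppr0 expR0 expr0 mulr1.
by rewrite Rintegral_cst// mul1r; move: mu_pos => /= ->.
Qed.

Lemma laplace_cvgy : laplace mu 0 n.+1%:R @[n --> \oo] --> (0 : R).
Proof.
have cvg0 : (\int[mu]_(x in `]0%R, +oo[)
      (x ^+ 0 * expR (- (n.+1%:R * x)))%:E)%E @[n --> \oo] -->
    (\int[mu]_(x in `]0%R, +oo[) cst 0 x)%E.
  apply: (@dominated_cvg _ _ _ mu _ _
    (fun n (x : R) => (x ^+ 0 * expR (- (n.+1%:R * x)))%:E) _ (cst 1%E)) => //.
  - move=> n; apply/measurable_EFinP; exact: laplace_kernel_measurable.
  - move=> x; rewrite /= in_itv/= andbT => x0.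
    apply: cvg_EFin; first exact: nearW.
    rewrite /comp/=; under eq_fun do rewrite expr0 mul1r.
    have expx : expR (- (y * x)) @[y --> +oo] --> (0 : R).
      apply: (@cvg_comp _ _ _ (fun y => y * x) (fun y => expR (- y)) _ +oo%R).
        exact: (gt0_cvgMly x0 cvg_id).
      exact: cvgr_expR.
    apply: (@cvg_comp _ _ _ (fun n => n.+1%:R) (fun y => expR (- (y * x))) _
      +oo%R _ _ expx).
    by have := @cvgr_idn R; rewrite -(cvg_shiftS (fun n => n%:R : R)).
  - exact: finite_measure_integrable_cst.
  - move=> n x x0 /=; rewrite lee_fin ger0_norm ?laplace_kernel_ge0//.
    by rewrite (le_trans (laplace_kernel_le 0 _ x0))// expr0.
move: cvg0; rewrite integral0 => /fine_cvg; exact.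
Qed.

Lemma Rintegral_pos_gt0 (f : R -> R) :
  mu.-integrable `]0%R, +oo[ (EFin \o f) -> (forall x, 0 < x -> 0 < f x) ->
  0 < \int[mu]_(x in `]0%R, +oo[) f x.
Proof.
move=> intf f0.
have mD : measurable (`]0%R, +oo[%classic : set R) by [].
have f0' x : `]0%R, +oo[%classic x -> 0 < f x.
  by rewrite /= in_itv/= andbT => /f0.
rewrite lt_neqAle; apply/andP; split; last first.
  by apply: Rintegral_ge0 => x /f0'/ltW.
rewrite eq_sym; apply/negP => /eqP if0.
have : (\int[mu]_(x in `]0%R, +oo[) `|(EFin \o f) x| = 0)%E.
  rewrite (_ : 0%E = (fine (\int[mu]_(x in `]0%R, +oo[) (f x)%:E))%:E).
    rewrite fineK; last exact: integrable_fin_num.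
    apply: eq_integral => x; rewrite inE => /f0' fx0.
    by rewrite /= gtr0_norm.
  by congr EFin.
move/(ae_eq_integral_abs mu mD) => /(_ (measurable_int _ intf)) [N [mN N0 DN]].
suff : (mu `]0%R, +oo[%classic <= mu N)%E by rewrite mu_pos N0 lee_fin ler10.
apply: le_measure; rewrite ?inE//.
move=> x x0; apply: DN => /= /(_ x0) [fx0].
by have := f0' x x0; rewrite fx0 ltxx.
Qed.

Lemma laplace_gt0 (k : nat) (s : R) : moment_finite mu k -> 0 <= s ->
  0 < laplace mu k s.
Proof.
move=> ik s0; apply: Rintegral_pos_gt0; first exact: laplace_kernel_integrable.
by move=> x x0; rewrite mulr_gt0 ?expR_gt0// exprn_gt0.
Qed.

Lemma one_minus_laplace (s : R) : 0 <= s ->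
  1 - laplace mu 0 s = \int[mu]_(x in `]0%R, +oo[) (1 - expR (- (s * x))).
Proof.
move=> s0; rewrite -[X in X - _]laplace00 /laplace -RintegralB//; last 2 first.
- exact: (laplace_kernel_integrable moment_finite0).
- exact: (laplace_kernel_integrable moment_finite0).
by apply: eq_Rintegral => x _; rewrite mul0r oppr0 expR0 expr0 !mul1r.
Qed.

Lemma one_minus_exp_integrable (s : R) : 0 <= s ->
  mu.-integrable `]0%R, +oo[ (EFin \o (fun x : R => 1 - expR (- (s * x)))).
Proof.
move=> s0; apply: (le_integrable _ _ _ (@moment_finite0)) => //.
  apply/measurable_EFinP; apply: measurable_funB => //.
  exact: measurable_expR_scaled.
move=> x /=; rewrite in_itv/= andbT => x0; rewrite expr0 normr1 lee_fin.
have := expR_ge0 (- (s * x)); have : expR (- (s * x)) <= 1.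
  by rewrite expR_le1 oppr_le0 mulr_ge0// ltW.
by move=> ? ?; rewrite ger0_norm; lra.
Qed.

Lemma laplace_lt1 (s : R) : 0 < s -> laplace mu 0 s < 1.
Proof.
move=> s0; rewrite -subr_gt0 one_minus_laplace ?ltW//.
apply: Rintegral_pos_gt0; first by apply: one_minus_exp_integrable; exact: ltW.
by move=> x x0; rewrite subr_gt0 expR_lt1 oppr_lt0 mulr_gt0.
Qed.

End laplace_lemmas.

(** * The Laplace transform determines the law *)

Lemma bernoulli_ineq (R : realDomainType) (n : nat) (x : R) : 0 <= x <= 1 ->
  1 - n%:R * x <= (1 - x) ^+ n.
Proof.
move=> /andP[x0 x1]; elim: n => [|n IH]; first by rewrite mul0r subr0 expr0.
rewrite exprS; apply: (@le_trans _ _ ((1 - x) * (1 - n%:R * x))).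
  have : 0 <= n%:R * (x * x) by rewrite !mulr_ge0.
  by rewrite -addn1 natrD; lra.
by rewrite ler_wpM2l// subr_ge0.
Qed.

Section laplace_uniqueness.
Context {R : realType}.

(** Expanding the power by the binomial formula, the integral of this function
is a linear combination of values of the Laplace transform; the parameter [b]
lets this be an induction on [K]. *)
Let kernel (a b : R) (K : nat) (x : R) : R :=
  (1 - expR (- (a * x))) ^+ K * expR (- (b * x)).

Let kernel01 (a b : R) (K : nat) (x : R) : 0 <= a -> 0 <= b -> 0 < x ->
  0 <= kernel a b K x <= 1.
Proof.
move=> a0 b0 x0.
have e1 (c : R) : 0 <= c -> 0 <= expR (- (c * x)) <= 1.
  by move=> c0; rewrite expR_ge0 expR_le1 oppr_le0 mulr_ge0// ltW.
have /andP[ea0 ea1] := e1 a a0; have /andP[eb0 eb1] := e1 b b0.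
have ga0 : 0 <= 1 - expR (- (a * x)) by rewrite subr_ge0.
rewrite mulr_ge0 ?exprn_ge0//= mulr_ile1 ?exprn_ge0// exprn_ile1// gerBl//.
Qed.

Let kernel_measurable (a b : R) (K : nat) (D : set R) :
  measurable_fun D (kernel a b K).
Proof.
apply: measurable_funTS; apply: measurable_funM.
  apply: measurable_funX; apply: measurable_funB => //.
  exact: measurable_expR_scaled.
exact: measurable_expR_scaled.
Qed.

Let kernel_integrable (mu : probability R R) (a b : R) (K : nat) :
  0 <= a -> 0 <= b -> mu.-integrable `]0%R, +oo[ (EFin \o kernel a b K).
Proof.
move=> a0 b0; apply: (le_integrable _ _ _ (moment_finite0 mu)) => //.
  by apply/measurable_EFinP; exact: kernel_measurable.
move=> x /=; rewrite in_itv/= andbT => x0; rewrite expr0 normr1 lee_fin.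
by have /andP[k0 k1] := kernel01 K a0 b0 x0; rewrite ger0_norm.
Qed.

Variables mu nu : probability R R.
Hypothesis mu_pos : mu `]0%R, +oo[%classic = 1%E.
Hypothesis nu_pos : nu `]0%R, +oo[%classic = 1%E.
Hypothesis eq_laplace : forall s : R, 0 < s -> laplace mu 0 s = laplace nu 0 s.

Let eq_kernel (a b : R) (K : nat) : 0 < a -> 0 <= b ->
  \int[mu]_(x in `]0%R, +oo[) kernel a b K x =
  \int[nu]_(x in `]0%R, +oo[) kernel a b K x.
Proof.
move=> a0; elim: K b => [|K IH] b b0.
  have k0 (m : probability R R) :
    \int[m]_(x in `]0%R, +oo[) kernel a b 0 x = laplace m 0 b by [].
  rewrite !k0; move: b0; rewrite le_eqVlt => /predU1P[<-|/eq_laplace//].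
  by rewrite !laplace00.
have step (m : probability R R) :
    \int[m]_(x in `]0%R, +oo[) kernel a b K.+1 x =
    \int[m]_(x in `]0%R, +oo[) kernel a b K x -
    \int[m]_(x in `]0%R, +oo[) kernel a (a + b) K x.
  rewrite -RintegralB//; last 2 first.
  - by apply: kernel_integrable => //; exact: ltW.
  - by apply: kernel_integrable; rewrite ?addr_ge0 ?(ltW a0).
  apply: eq_Rintegral => x _; rewrite /kernel mulrDl opprD expRD exprS.
  by ring.
by rewrite !step !IH// addr_ge0// ltW.
Qed.

(** The scale [ln 2 / t] puts the threshold at [t]: with N = n + 1, the product
N 2^N exp(- N x ln 2 / t) equals N exp(N (t - x) ln 2 / t), which tends to 0 for
x > t and to infinity for x <= t.  The extra factor N in the exponent of the
power decides the case x = t. *)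
Let cutoff (t : R) (n : nat) : R -> R :=
  kernel (n.+1%:R * (ln 2 / t)) 0 (n.+1 * 2 ^ n.+1).

Let cutoff_cvg (t x : R) : 0 < t -> 0 < x ->
  cutoff t n x @[n --> \oo] --> (\1_(`]t, +oo[%classic) x : R).
Proof.
move=> t0 x0; have [a aE] : {a : R | ln 2 / t = a} by exists (ln 2 / t).
have a0 : 0 < a by rewrite -aE divr_gt0// ln_gt0// ltr1n.
have at2 : a * t = ln 2 by rewrite -aE divfK// gt_eqF.
have e01 n : 0 <= expR (- (n.+1%:R * a * x)) <= 1.
  by rewrite expR_ge0 expR_le1 oppr_le0 !mulr_ge0 ?(ltW a0) ?(ltW x0).
have cutoffE n : cutoff t n x = 
    (1 - expR (- (n.+1%:R * a * x))) ^+ (n.+1 * 2 ^ n.+1).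
  by rewrite /cutoff /kernel aE mul0r oppr0 expR0 mulr1.
have Ke n : (n.+1 * 2 ^ n.+1)%:R * expR (- (n.+1%:R * a * x)) =
    n.+1%:R * expR (n.+1%:R * (a * (t - x))).
  rewrite natrM natrX -mulrA; congr (_ * _).
  rewrite -[X in X ^+ _](@lnK R) ?posrE ?ltr0n// -expRM_natl -expRD -at2.
  by congr expR; ring.
rewrite indicE; have [tx|xt] := ltP t x.
  rewrite mem_set/=; last by rewrite in_itv/= tx.
  (* Bernoulli's inequality leaves N exp(- N c) with c = a (x - t), and
     exp(N c) >= (N c)^2 / 2. *)
  have c0 : 0 < a * (x - t) by rewrite mulr_gt0// subr_gt0.
  have lower n : 1 - (2 / (a * (x - t)) ^+ 2) * n.+1%:R^-1 <= cutoff t n x.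
    rewrite cutoffE (le_trans _ (bernoulli_ineq _ (e01 n)))// Ke lerD2l lerN2.
    have -> : a * (t - x) = - (a * (x - t)) by ring.
    set c := a * (x - t) in c0 *; have m0 : 0 < n.+1%:R :> R by [].
    rewrite mulrN expRN ler_pdivrMr ?expR_gt0//.
    have mc0 : 0 <= n.+1%:R * c by rewrite mulr_ge0 ?(ltW c0).
    have expc : 1 + (n.+1%:R * c) ^+ 2 / 2 <= expR (n.+1%:R * c).
      exact: (expR_ge1Dxn 1 mc0).
    apply: (@le_trans _ _ (2 / c ^+ 2 / n.+1%:R * ((n.+1%:R * c) ^+ 2 / 2))).
      by rewrite le_eqVlt; apply/orP; left; apply/eqP; field; rewrite !gt_eqF.
    rewrite ler_wpM2l ?divr_ge0 ?exprn_ge0 ?(ltW c0)//.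
    by rewrite (le_trans _ expc)// lerDr.
  apply: (@squeeze_cvgr _ _ _ _
    (fun n => 1 - (2 / (a * (x - t)) ^+ 2) * n.+1%:R^-1) (cst 1)) => //.
  - apply: nearW => n; rewrite lower/=.
    have n0 : 0 <= n.+1%:R * (ln 2 / t) by rewrite aE mulr_ge0 ?(ltW a0).
    by have /andP[] := kernel01 (n.+1 * 2 ^ n.+1) n0 (lexx 0) x0.
  - rewrite -[X in _ --> X]subr0; apply: cvgB; first exact: cvg_cst.
    rewrite -(mulr0 (2 / (a * (x - t)) ^+ 2)).
    by apply: cvgMr; exact: cvg_harmonic.
  - exact: cvg_cst.
rewrite memNset/=; last by rewrite in_itv/= andbT; apply/negP; rewrite -leNgt.
have upper n : cutoff t n x <= expR (- n.+1%:R).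
  (* 1 - y <= exp(- y) bounds the power by exp(- N exp(N a (t - x))). *)
  rewrite cutoffE; have /andP[_ e1] := e01 n.
  apply: (@le_trans _ _ (expR (- expR (- (n.+1%:R * a * x)))
      ^+ (n.+1 * 2 ^ n.+1))).
    by rewrite lerXn2r ?nnegrE ?subr_ge0 ?expR_ge0// expR_ge1Dx.
  rewrite -expRM_natl ler_expR mulrN lerN2 Ke ler_peMr//.
  by rewrite -expR0 ler_expR !mulr_ge0 ?subr_ge0 ?(ltW a0).
apply: (@squeeze_cvgr _ _ _ _ (cst 0) (fun n => expR (- n.+1%:R))) => //.
- apply: nearW => n; rewrite upper/= andbT.
  have n0 : 0 <= n.+1%:R * (ln 2 / t) by rewrite aE mulr_ge0 ?(ltW a0).
  by have /andP[] := kernel01 (n.+1 * 2 ^ n.+1) n0 (lexx 0) x0.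
- exact: cvg_cst.
- by have := @cvgn_expR R; rewrite -(cvg_shiftS (fun n => expR (- n%:R) : R)).
Qed.

Let cutoff_integral_cvg (m : probability R R) (t : R) : 0 < t ->
  (\int[m]_(x in `]0%R, +oo[) (cutoff t n x)%:E)%E @[n --> \oo] -->
  m `]t, +oo[%classic.
Proof.
move=> t0.
have -> : m `]t, +oo[%classic =
    (\int[m]_(x in `]0%R, +oo[) (\1_(`]t, +oo[%classic) x)%:E)%E.
  rewrite integral_indic// setIidl//.
  by apply: subset_itvr; rewrite bnd_simp ltW.
apply: (@dominated_cvg _ _ _ m _ _
  (fun n x => (cutoff t n x)%:E) _ (cst 1%E)) => //.
- by move=> n; apply/measurable_EFinP; exact: kernel_measurable.
- move=> x; rewrite /= in_itv/= andbT => x0.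
  by apply: cvg_EFin; [exact: nearW|exact: cutoff_cvg].
- exact: finite_measure_integrable_cst.
- move=> n x; rewrite /= in_itv/= andbT => x0.
  have n0 : 0 <= n.+1%:R * (ln 2 / t).
    by rewrite mulr_ge0// divr_ge0 ?ln_ge0 ?ler1n// ltW.
  have /andP[k0 k1] := kernel01 (n.+1 * 2 ^ n.+1) n0 (lexx 0) x0.
  by rewrite lee_fin ger0_norm.
Qed.

Let eq_ray (t : R) : mu `]t, +oo[%classic = nu `]t, +oo[%classic.
Proof.
have [t0|t0] := ltP 0 t; last first.
  have one (m : probability R R) : m `]0%R, +oo[%classic = 1%E ->
      m `]t, +oo[%classic = 1%E.
    move=> m1; apply/eqP; rewrite eq_le probability_le1//= -m1.
    by apply: le_measure; rewrite ?inE//; apply: subset_itvr; rewrite bnd_simp.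
  by rewrite !one.
have eq_n n : (\int[mu]_(x in `]0%R, +oo[) (cutoff t n x)%:E =
               \int[nu]_(x in `]0%R, +oo[) (cutoff t n x)%:E)%E.
  have n0 : 0 < n.+1%:R * (ln 2 / t).
    by rewrite mulr_gt0// divr_gt0// ln_gt0// ltr1n.
  have fin (m : probability R R) : (\int[m]_(x in `]0%R, +oo[) (cutoff t n x)%:E
      = (\int[m]_(x in `]0%R, +oo[) cutoff t n x)%:E)%E.
    rewrite /Rintegral fineK//; apply: integrable_fin_num => //.
    by apply: kernel_integrable => //; exact: ltW.
  by rewrite !fin eq_kernel.
have := cutoff_integral_cvg (m := mu) t0; under eq_fun do rewrite eq_n.
by move=> mucvg; exact: cvg_unique mucvg (cutoff_integral_cvg t0).
Qed.

(** Two laws with the same Laplace transform agree on the rays [`]t, +oo[], a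
generating family stable under intersection. *)
Lemma laplace_unique (B : set R) : measurable B -> mu B = nu B.
Proof.
move=> mB.
apply: (measure_unique (@RGenOInfty.G R) (fun n => `](- n%:R), +oo[%classic)).
- exact: RGenOInfty.measurableE.
- move=> _ _ [x ->] [y ->]; exists (Num.max x y).
  apply/seteqP; split => z /=; rewrite !in_itv/= !andbT gt_max.
    by move=> [-> ->].
  by move=> /andP.
- by move=> n; exists (- n%:R).
- apply/seteqP; split => // x _; exists (Num.truncn `|x|).+1 => //=.
  rewrite in_itv/= andbT ltrNl (le_lt_trans (ler_norm _))// normrN.
  exact: truncnS_gt.
- by move=> _ [t ->]; exact: eq_ray.
- by move=> n; rewrite (le_lt_trans (probability_le1 _ _))// ltry.
- exact: mB.
Qed.

End laplace_uniqueness.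

(** * Exponential laws *)

Import HBNNSimple.

Lemma ge0_integral_density d (T : measurableType d) (R : realType)
    (m nu : {measure set T -> \bar R}) (g : T -> R) :
  measurable_fun [set: T] g -> (forall x, 0 <= g x) ->
  (forall A, measurable A -> nu A = \int[m]_(x in A) (g x)%:E)%E ->
  forall f : T -> \bar R, measurable_fun [set: T] f ->
    (forall x, 0 <= f x)%E ->
  (\int[nu]_x f x = \int[m]_x (f x * (g x)%:E))%E.
Proof.
move=> mg g0 nuE f mf f0.
have mEg : measurable_fun [set: T] (EFin \o g) by exact/measurable_EFinP.
pose h := nnsfun_approx measurableT mf.
have indicE (A : set T) : measurable A ->
    (\int[nu]_x (\1_A x)%:E = \int[m]_x ((\1_A x)%:E * (g x)%:E))%E.
  move=> mA; rewrite integral_indic// setIT nuE// integral_mkcond.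
  apply: eq_integral => x _; rewrite patchE indicE.
  by case: ifPn => _; rewrite ?mul1e ?mul0e.
have nnsfunE (k : {nnsfun T >-> R}) :
    (\int[nu]_x (k x)%:E = \int[m]_x ((k x)%:E * (g x)%:E))%E.
  under eq_integral do rewrite fimfunE -fsumEFin//.
  rewrite ge0_integral_fsum//; last 2 first.
  - by move=> r; exact/measurable_EFinP/measurableT_comp.
  - by move=> r x _; rewrite EFinM nnfun_muleindic_ge0.
  under [RHS]eq_integral.
    move=> x _; rewrite fimfunE -fsumEFin// ge0_mule_fsuml; last first.
      by move=> r; rewrite EFinM nnfun_muleindic_ge0.
    over.
  rewrite [RHS]ge0_integral_fsum//; last 2 first.
  - move=> r; apply: emeasurable_funM => //.
    by apply/measurable_EFinP; do 2 apply/measurableT_comp => //.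
  - move=> r x _; rewrite mule_ge0 ?lee_fin//.
    by rewrite -lee_fin EFinM nnfun_muleindic_ge0.
  apply: eq_fsbigr => r; rewrite inE => -[y _ <-].
  under eq_integral do rewrite EFinM.
  rewrite ge0_integralZl//; last 2 first.
  - exact/measurable_EFinP.
  - by rewrite lee_fin.
  rewrite indicE//.
  under [RHS]eq_integral do rewrite EFinM -muleA.
  rewrite [RHS]ge0_integralZl//; last 3 first.
  - by apply: emeasurable_funM => //; exact/measurable_EFinP.
  - by move=> x _; rewrite mule_ge0// lee_fin.
  - by rewrite lee_fin.
transitivity (lim ((\int[nu]_x (h n x)%:E)%E @[n --> \oo])).
  rewrite -monotone_convergence//=.
  - apply: eq_integral => x _; apply/esym/cvg_lim => //.
    exact: cvg_nnsfun_approx.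
  - by move=> n; exact/measurable_EFinP.
  - by move=> n x _; rewrite lee_fin.
  - by move=> x _ a b ab; rewrite lee_fin; exact/lefP/nd_nnsfun_approx.
have -> : (fun n => \int[nu]_x (h n x)%:E)%E =
    (fun n => \int[m]_x ((h n x)%:E * (g x)%:E))%E.
  by apply/funext => n; exact: nnsfunE.
rewrite -monotone_convergence//=.
- apply: eq_integral => x _; apply/cvg_lim => //.
  by apply: cvgeZr => //; exact: cvg_nnsfun_approx.
- by move=> n; apply: emeasurable_funM => //; exact/measurable_EFinP.
- by move=> n x _; rewrite mule_ge0// lee_fin.
- move=> x _ a b ab; rewrite lee_wpmul2r ?lee_fin//.
  exact/lefP/nd_nnsfun_approx.
Qed.

(** The type of reals carries its canonical measurable structure and, as
[measurableTypeR R], the same measurable sets under another display; Lebesgue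
measure and the usual distributions live on the latter.  The identity map
transports measures and integrals from one to the other. *)
Section change_of_display.
Context {R : realType}.

Let idR (x : measurableTypeR R) : R := x.

Let measurable_idR : measurable_fun [set: measurableTypeR R] idR.
Proof. by move=> _ B mB; rewrite setTI. Qed.

HB.instance Definition _ := isMeasurableFun.Build _ _ _ _ idR measurable_idR.

Lemma ge0_integral_measurableTypeR (mu : {measure set R -> \bar R})
    (nu : {measure set (measurableTypeR R) -> \bar R}) (f : R -> \bar R) :
  (forall B : set R, measurable B -> mu B = nu B) ->
  measurable_fun [set: R] f -> (forall x, 0 <= f x)%E ->
  (\int[mu]_x f x = \int[nu]_x f x)%E.
Proof.
move=> munu mf f0.
rewrite (@eq_measure_integral _ _ _ _ (pushforward nu idR)).
  by rewrite ge0_integral_pushforward.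
by move=> B mB _; rewrite munu.
Qed.

Lemma probability_of_measurableTypeR (nu : probability (measurableTypeR R) R) :
  exists mu : probability R R, forall B : set R, measurable B -> mu B = nu B.
Proof. by exists (distribution nu idR). Qed.

End change_of_display.

Section exponential_laplace.
Context {R : realType}.

(** The canonical probability structure depends on a proof that the rate is
positive, hence has to be named. *)
Definition exponential_law (K : R) (K0 : 0 < K) :
    probability (measurableTypeR R) R :=
  exponential_distribution_exponential_prob__canonical__probability_measure_Probability
    K0.

Lemma exponential_probability (K : R) : 0 < K ->
  exists E : probability R R, has_law E idfun (exponential_prob K).
Proof.
move=> K0.
have [E EE] := probability_of_measurableTypeR (exponential_law K0).
by exists E => B mB; rewrite -EE.
Qed.

Lemma exponential_prob_pos (K : R) : 0 < K ->
  exponential_prob K `]0%R, +oo[%classic = 1%E.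
Proof.
move=> K0; rewrite /exponential_prob integral_itv_obnd_cbnd; last first.
  by apply/measurable_EFinP/measurable_funTS; exact: measurable_exponential_pdf.
rewrite -(integral_exponential_pdf K0) [LHS]integral_mkcond.
apply: eq_integral => x _; rewrite patchE; case: ifPn => //.
rewrite notin_setE/= in_itv/= andbT => /negP; rewrite -ltNge => x0.
by rewrite lt0_exponential_pdf.
Qed.

(** Multiplying the density of rate [K] by [expR (- (s * x))] gives
[K / (K + s)] times the density of rate [K + s]. *)
Lemma laplace_exponential (K s : R) (mu : probability R R) : 0 < K -> 0 <= s ->
  has_law mu idfun (exponential_prob K) -> laplace mu 0 s = K / (K + s).
Proof.
move=> K0 s0 muE; apply: EFin_inj.
have Ks0 : 0 < K + s by rewrite ltr_pwDl.
rewrite (EFin_laplace (moment_finite0 mu) s0) integral_mkcond.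
have fm : measurable_fun [set: R] ((fun x : R =>
    (x ^+ 0 * expR (- (s * x)))%:E) \_ `]0%R, +oo[).
  apply/(measurable_restrictT _ _).1 => //.
  by apply/measurable_EFinP; exact: laplace_kernel_measurable.
have f0 x : (0 <= ((fun x : R =>
    (x ^+ 0 * expR (- (s * x)))%:E) \_ `]0%R, +oo[) x)%E.
  rewrite patchE; case: ifPn => //; rewrite inE => x0.
  by rewrite lee_fin laplace_kernel_ge0.
rewrite (ge0_integral_measurableTypeR (nu := exponential_law K0))//.
rewrite (ge0_integral_density (g := exponential_pdf K)
  (m := lebesgue_measure))//; last 2 first.
- exact: measurable_exponential_pdf.
- by move=> x; apply: exponential_pdf_ge0; exact: ltW.
transitivity (\int[lebesgue_measure]_(x in `]0%R, +oo[)
    ((K / (K + s))%:E * (exponential_pdf (K + s) x)%:E))%E.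
  rewrite [RHS]integral_mkcond; apply: eq_integral => x _.
  rewrite !patchE; case: ifPn => [|_]; last by rewrite mul0e.
  rewrite inE/= in_itv/= andbT => x0.
  rewrite !exponential_pdfE ?ltW// -!EFinM; congr EFin.
  rewrite expr0 mul1r mulrCA -expRD mulrA divfK ?gt_eqF//.
  by congr (_ * expR _); ring.
rewrite ge0_integralZl//; last 3 first.
- by apply/measurable_EFinP/measurable_funTS; exact: measurable_exponential_pdf.
- by move=> x _; rewrite lee_fin exponential_pdf_ge0// ltW.
- by rewrite lee_fin divr_ge0// ltW.
have := exponential_prob_pos Ks0; rewrite /exponential_prob => ->.
by rewrite mule1.
Qed.

End exponential_laplace.

(** Derivatives only see a neighbourhood, so formulas valid for positive
arguments may be differentiated. *)
Lemma eq_pos_derive (R : realType) (f g : R -> R) (s a b : R) :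
  (forall x, 0 < x -> f x = g x) -> 0 < s ->
  is_derive s 1 f a -> is_derive s 1 g b -> a = b.
Proof.
move=> fg s0 fa gb.
rewrite -(@derive_val _ _ _ _ _ _ _ fa) -(@derive_val _ _ _ _ _ _ _ gb).
apply: near_eq_derive.
near=> x; apply: fg; near: x; exact: lt_nbhsr.
Unshelve. all: end_near. Qed.

Section exponential_moments.
Context {R : realType} (mu : probability R R) (K : R).
Hypotheses (K0 : 0 < K) (muE : has_law mu idfun (exponential_prob K)).
Hypotheses (mu1 : moment_finite mu 1) (mu2 : moment_finite mu 2).

(** For [s > 0] these are derivatives of [K / (K + s)]; the moments, at [s = 0],
follow by right continuity. *)
Lemma laplace1_exponential (s : R) : 0 <= s ->
  laplace mu 1 s = K / (K + s) ^+ 2.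
Proof.
have pos (x : R) : 0 < x -> laplace mu 1 x = K / (K + x) ^+ 2.
  move=> x0; apply: oppr_inj.
  have Kx : K + x != 0 by rewrite gt_eqF// addr_gt0.
  apply: (eq_pos_derive (f := laplace mu 0)
    (g := fun x => K * (K + x)^-1) _ x0).
  - by move=> y y0; rewrite (laplace_exponential K0 (ltW y0) muE).
  - exact: laplace_derive (moment_finite0 mu) mu1 x0.
  - have dV := @is_deriveV _ (fun x => K + x) x _ _ Kx _.
    by apply: is_derive_eq; rewrite /GRing.scale/=; field.
rewrite le_eqVlt => /predU1P[<-|/pos//].
have lim : laplace mu 1 x @[x --> 0^'+] --> K * ((K + 0) ^+ 2)^-1.
  apply: (@cvg_trans _ (K * ((K + x) ^+ 2)^-1 @[x --> 0^'+])).
    by apply: near_eq_cvg; near=> x; rewrite pos.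
  apply: cvgMr; apply: cvgV; first by rewrite expf_neq0// addr0 gt_eqF.
  apply: cvgM; apply: cvgD; (try exact: cvg_cst);
    by apply: cvg_at_right_filter; exact: cvg_id.
exact: cvg_unique (laplace_cvg0 mu1) lim.
Unshelve. all: end_near. Qed.

Lemma laplace2_exponential (s : R) : 0 <= s ->
  laplace mu 2 s = 2 * K / (K + s) ^+ 3.
Proof.
have pos (x : R) : 0 < x -> laplace mu 2 x = 2 * K / (K + x) ^+ 3.
  move=> x0; apply: oppr_inj.
  have Kx : K + x != 0 by rewrite gt_eqF// addr_gt0.
  have Kx2 : (K + x) ^+ 2 != 0 by rewrite expf_neq0.
  apply: (eq_pos_derive (f := laplace mu 1)
    (g := fun x => K * ((K + x) ^+ 2)^-1) _ x0).
  - by move=> y y0; rewrite laplace1_exponential// ltW.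
  - exact: laplace_derive mu1 mu2 x0.
  - have dV := @is_deriveV _ (fun x => (K + x) ^+ 2) x _ _ Kx2 _.
    by apply: is_derive_eq; rewrite /GRing.scale/=; field.
rewrite le_eqVlt => /predU1P[<-|/pos//].
have lim : laplace mu 2 x @[x --> 0^'+] --> 2 * K * ((K + 0) ^+ 3)^-1.
  apply: (@cvg_trans _ (2 * K * ((K + x) ^+ 3)^-1 @[x --> 0^'+])).
    by apply: near_eq_cvg; near=> x; rewrite pos.
  apply: cvgMr; apply: cvgV; first by rewrite expf_neq0// addr0 gt_eqF.
  apply: (cvg_comp _ (fun y => y ^+ 3)); last exact: exprn_continuous.
  apply: cvgD; first exact: cvg_cst.
  by apply: cvg_at_right_filter; exact: cvg_id.
exact: cvg_unique (laplace_cvg0 mu2) lim.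
Unshelve. all: end_near. Qed.

End exponential_moments.

(** * The differential equation *)

Lemma derive0_pos_cst (R : realType) (f : R -> R) :
  (forall x : R, 0 < x -> is_derive x 1 f 0) ->
  forall x y, 0 < x -> 0 < y -> f x = f y.
Proof.
move=> df x y.
wlog xy : x y / x <= y.
  by move=> H x0 y0; case: (leP x y) => [/H|/ltW/H]->.
move=> x0 y0; apply/esym/eqP; rewrite -subr_eq0.
have pos z : z \in `[x, y] -> 0 < z.
  by rewrite in_itv/= => /andP[xz _]; exact: lt_le_trans xz.
have [z zxy|/=|z _ ->] := @MVT_segment _ f (cst 0) x y xy;
  last by rewrite mul0r.
  by apply: df; apply: pos; exact: subset_itv_oo_cc zxy.
apply: derivable_within_continuous => z zxy.
exact: (@ex_derive _ _ _ _ _ _ _ (df z (pos z zxy))).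
Qed.

(** Here [phi1] and [phi2] stand for - phi' and phi''.  Both integrations are
explicit: [H] and [V] below have zero derivative; [H] vanishes because of the
behaviour at 0, and the behaviour of [phi] at infinity determines [c]. *)
Lemma laplace_ode (R : realType) (phi phi1 phi2 : R -> R) (c m : R) :
  (forall s : R, 0 < s -> is_derive s 1 phi (- phi1 s)) ->
  (forall s : R, 0 < s -> is_derive s 1 phi1 (- phi2 s)) ->
  (forall s : R, 0 < s -> 0 < phi s < 1) ->
  phi s @[s --> 0^'+] --> (1 : R) ->
  phi1 s @[s --> 0^'+] --> m ->
  phi n.+1%:R @[n --> \oo] --> (0 : R) ->
  (forall s : R, 0 < s -> s * phi2 s = c * (phi1 s * (1 - phi s))) ->
  exists2 K : R, 0 < K & forall s : R, 0 < s -> phi s = K / (K + s).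
Proof.
move=> dphi dphi1 phi01 phi0 phi10 phioo eqn.
pose H (s : R) : R :=
  (1 - phi s) - s * phi1 s - c / 2 * ((1 - phi s) * (1 - phi s)).
have H0 (s : R) : 0 < s -> H s = 0.
  move=> s0.
  have dH (x : R) : 0 < x -> is_derive x 1 H 0.
    move=> x0; have d0 := dphi _ x0; have d1 := dphi1 _ x0.
    rewrite /H; apply: is_derive_eq.
    rewrite /GRing.scale/=.
    have := eqn x x0; lra.
  have Hc : H x @[x --> 0^'+] --> H s.
    apply: (@cvg_trans _ (H s @[x --> 0^'+])); last exact: cvg_cst.
    apply: near_eq_cvg; near=> x; apply: (derive0_pos_cst dH) => //.
  have : H x @[x --> 0^'+] --> (1 - 1) - 0 * m - c / 2 * ((1 - 1) * (1 - 1)).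
    apply: cvgB; first apply: cvgB.
    - by apply: cvgB => //; exact: cvg_cst.
    - by apply: cvgM => //; apply: cvg_at_right_filter; exact: cvg_id.
    - by apply: cvgMr; apply: cvgM; apply: cvgB => //; exact: cvg_cst.
  rewrite subrr !mul0r mulr0 !subr0 => h; exact: (cvg_unique _ Hc h).
pose V (s : R) : R := s * (1 - phi s)^-1 - c / 2 * s.
have dV (x : R) : 0 < x -> is_derive x 1 V 0.
  move=> x0; have d0 := dphi _ x0.
  have g0 : 1 - phi x != 0 by have := phi01 _ x0; lra.
  have dg := @is_deriveV _ (fun x => 1 - phi x) x _ _ g0 _.
  rewrite /V; apply: is_derive_eq.
  rewrite /GRing.scale/=.
  have h := H0 x x0; rewrite /H in h.
  have -> : c / 2 = ((1 - phi x) - x * phi1 x) / ((1 - phi x) * (1 - phi x)).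
    rewrite -[LHS](mulfK (mulf_neq0 g0 g0)); congr (_ / _).
    by move: h => /eqP; rewrite subr_eq0 => /eqP->.
  by field.
have g0 (x : R) : 0 < x -> 1 - phi x != 0 by move=> /phi01; lra.
pose K := V 1.
have gK (x : R) : 0 < x -> (1 - phi x) * (K + c / 2 * x) = x.
  move=> x0; rewrite /K (derive0_pos_cst dV ltr01 x0) /V subrK.
  by rewrite mulrCA mulfV ?mulr1// g0.
have c2 : c / 2 = 1.
  have lim : (1 - phi n.+1%:R) * (K * n.+1%:R^-1 + c / 2) @[n --> \oo]
      --> (1 - 0) * (K * 0 + c / 2).
    apply: cvgM; first by apply: cvgB => //; exact: cvg_cst.
    apply: cvgD; last exact: cvg_cst.
    by apply: cvgMr; exact: cvg_harmonic.
  have lim1 : (1 - phi n.+1%:R) * (K * n.+1%:R^-1 + c / 2) @[n --> \oo]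
      --> (1 : R).
    apply: (@cvg_trans _ ((1 : R) @[n --> \oo])); last exact: cvg_cst.
    apply: near_eq_cvg; near=> n.
    have n0 : n.+1%:R != 0 :> R by rewrite pnatr_eq0.
    apply: (mulIf n0); rewrite mul1r -[LHS](gK n.+1%:R)// -[RHS]mulrA.
    by congr (_ * _); rewrite mulrDl divfK.
  have : (1 - 0) * (K * 0 + c / 2) = 1 by exact: cvg_unique lim lim1.
  by rewrite subr0 mulr0 add0r mul1r.
have {}gK (x : R) : 0 < x -> (1 - phi x) * (K + x) = x.
  by move=> x0; rewrite -[RHS]gK// c2 mul1r.
have K0 : 0 < K.
  rewrite -(@pmulr_rgt0 _ (1 - phi 1)); last by have := phi01 1 ltr01; lra.
  by have := gK 1 ltr01; have := phi01 1 ltr01; lra.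
exists K => // x x0.
have Kx0 : K + x != 0 by rewrite gt_eqF// addr_gt0.
by apply: (mulIf Kx0); rewrite divfK//; have := gK x x0; lra.
Unshelve. all: end_near. Qed.

(** * Power-biased transforms *)

Section positive_laws.
Context {R : realType}.

Lemma ge0_integral_pos (mu : probability R R) (g : R -> \bar R) :
  mu `]0%R, +oo[%classic = 1%E ->
  measurable_fun [set: R] g -> (forall x, 0 <= g x)%E ->
  (\int[mu]_x g x = \int[mu]_(x in `]0%R, +oo[) g x)%E.
Proof.
move=> mu1 mg g0.
have muN : mu (~` `]0%R, +oo[%classic) = 0%E.
  by rewrite probability_setC// [X in (_ - X)%E]mu1 subee.
have mN : measurable (~` `]0%R, +oo[%classic : set R) by exact: measurableC.
by rewrite (ge0_negligible_integral mN _ mg _ muN)// setTD setCK.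
Qed.

Lemma laplace_integralT (mu : probability R R) (s : R) :
  mu `]0%R, +oo[%classic = 1%E -> 0 <= s ->
  (laplace mu 0 s)%:E = (\int[mu]_x (expR (- (s * x)))%:E)%E.
Proof.
move=> mu1 s0; rewrite (EFin_laplace (moment_finite0 mu) s0).
rewrite ge0_integral_pos//.
- by apply: eq_integral => x _; rewrite expr0 mul1r.
- exact: measurable_EFin_expR_scaled.
Qed.

Context d (T : measurableType d) (P : probability T R) (Y : {RV P >-> R}).
Hypothesis Ypos : P [set w | 0 < Y w] = 1%E.

Lemma distribution_pos : distribution P Y `]0%R, +oo[%classic = 1%E.
Proof.
rewrite -Ypos; congr (P _).
by apply/seteqP; split => w /=; rewrite in_itv/= andbT.
Qed.

(** Restricting to the positive half-line discards the null event [Y <= 0],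
where [g \o Y] is allowed to be negative and need not be integrable. *)
Lemma expectation_pos (g : R -> R) :
  measurable_fun [set: R] g -> (forall x, 0 < x -> 0 <= g x) ->
  ('E_P[g \o Y] = \int[distribution P Y]_(x in `]0%R, +oo[) (g x)%:E)%E.
Proof.
move=> mg g0; rewrite unlock [RHS]integral_mkcond.
have mrestr : measurable_fun [set: R] ((EFin \o g) \_ `]0%R, +oo[).
  apply/(measurable_restrictT _ _).1 => //.
  by apply/measurable_EFinP; exact: measurable_funTS.
rewrite ge0_integral_distribution//; last first.
  move=> x; rewrite patchE; case: ifPn => //.
  rewrite inE/= in_itv/= andbT => x0.
  by rewrite lee_fin g0.
apply: ae_eq_integral => //.
- by apply/measurable_EFinP; exact: measurableT_comp.
- exact: measurableT_comp.
have mYpos : measurable [set w | 0 < Y w].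
  by rewrite -[X in measurable X]setTI; apply: measurable_fun_ltr.
have PN : P (~` [set w | 0 < Y w]) = 0%E.
  by rewrite probability_setC// [X in (_ - X)%E]Ypos subee.
exists (~` [set w | 0 < Y w]); split => //.
- exact: measurableC.
- move=> w /=; apply: contra_not => /= Yw _.
  by rewrite patchE ifT// inE/= in_itv/= andbT.
Qed.

End positive_laws.

Section power_transform.
Context {R : realType} d d' (T : measurableType d) (T' : measurableType d')
  (P : probability T R) (Q : probability T' R).
Variables (Y : {RV P >-> R}) (W : {RV Q >-> R}) (k : nat).
Hypothesis Ypos : P [set w | 0 < Y w] = 1%E.
Hypothesis YW : is_transform (fun y : R => y ^+ k) Y W.

Let mu : probability R R := distribution P Y.
Let nu : probability R R := distribution Q W.

Let expectation_power :
  ('E_P[(fun y : R => y ^+ k)%R \o Y] =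
   \int[mu]_(x in `]0%R, +oo[) (x ^+ k)%:E)%E.
Proof.
by rewrite expectation_pos// => x x0; rewrite exprn_ge0// ltW.
Qed.

Lemma transform_moment_finite : moment_finite mu k.
Proof.
have [_ _ /andP[_ Yfin] _] := YW.
apply/integrableP; split.
  by apply/measurable_EFinP; exact: measurable_funTS.
rewrite expectation_power in Yfin; apply: le_lt_trans Yfin.
apply: ge0_le_integral => //.
- by apply/measurable_EFinP; apply: measurableT_comp.
- by apply/measurable_EFinP; exact: measurable_funTS.
- move=> x; rewrite /= in_itv/= andbT => x0.
  by rewrite lee_fin ger0_norm// exprn_ge0// ltW.
Qed.

Lemma laplace_moment (m : probability R R) (j : nat) : moment_finite m j ->
  (laplace m j 0)%:E = (\int[m]_(x in `]0%R, +oo[) (x ^+ j)%:E)%E.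
Proof.
move=> mj; rewrite EFin_laplace//; apply: eq_integral => x _.
by rewrite mul0r oppr0 expR0 mulr1.
Qed.

Let moment_gt0 : 0 < laplace mu k 0.
Proof.
have [_ _ /andP[Ygt0 _] _] := YW.
rewrite -lte_fin laplace_moment -?expectation_power//.
exact: transform_moment_finite.
Qed.

Lemma transform_integral (f : R -> R) : measurable_fun [set: R] f ->
  (forall x, 0 <= f x) ->
  (\int[nu]_x (f x)%:E =
   (laplace mu k 0)^-1%:E * \int[mu]_(x in `]0%R, +oo[) (x ^+ k * f x)%:E)%E.
Proof.
move=> mf f0; have [_ _ _ /(_ f mf f0)] := YW.
rewrite {1}unlock ge0_integral_distribution//; last exact/measurable_EFinP.
move=> WE; rewrite -[LHS]/(\int[Q]_w ((f \o W) w)%:E)%E WE.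
rewrite expectation_power -laplace_moment; last first.
  exact: transform_moment_finite.
rewrite inver gt_eqF// muleC; congr (_ * _)%E.
rewrite (_ : _ \* _ = (fun y => y ^+ k * f y) \o Y)// expectation_pos//.
- by apply: measurable_funM => //.
- by move=> x x0; rewrite mulr_ge0// exprn_ge0// ltW.
Qed.

Lemma transform_pos : nu `]0%R, +oo[%classic = 1%E.
Proof.
have := @transform_integral (\1_(`]0%R, +oo[%classic)) _ _.
rewrite integral_indic// setIT => ->//.
rewrite (_ : (\int[mu]_(x in _) _)%E = (laplace mu k 0)%:E).
  by rewrite -EFinM mulVf// gt_eqF.
rewrite laplace_moment; last exact: transform_moment_finite.
by apply: eq_integral => x x0; rewrite indicE x0 mulr1.
Qed.

Lemma laplace_transform (s : R) : 0 <= s ->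
  laplace nu 0 s = laplace mu k s / laplace mu k 0.
Proof.
move=> s0; apply: EFin_inj; rewrite laplace_integralT//; last first.
  exact: transform_pos.
rewrite transform_integral; last 2 first.
- exact: measurable_expR_scaled.
- by move=> x; rewrite expR_ge0.
by rewrite mulrC EFinM EFin_laplace//; exact: transform_moment_finite.
Qed.

End power_transform.

(** * Independent sums with a uniform factor *)

Lemma mutually_independent_triple (R : realType) d (T : measurableType d)
    (Q : probability T R) (X1 X2 X3 X4 : {RV Q >-> R}) :
  mutually_independent (tnth [tuple X1; X2; X3; X4]) ->
  forall A B D : set R, measurable A -> measurable B -> measurable D ->
  Q (X1 @^-1` A `&` (X4 @^-1` B `&` X2 @^-1` D)) =
  (Q (X1 @^-1` A) * (Q (X4 @^-1` B) * Q (X2 @^-1` D)))%E.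
Proof.
move=> ind A B D mA mB mD.
pose C : 'I_4 -> set R := tnth [tuple A; D; setT; B].
have mC i : measurable (C i).
  by case: i => -[|[|[|[|//]]]] ?; rewrite /C (tnth_nth setT)/=.
have := ind [set: 'I_4]%SET C mC.
rewrite (eq_bigl xpredT); last by move=> i; rewrite inE.
rewrite !big_ord_recl big_ord0 /C !(tnth_nth setT) !(tnth_nth X1)/=.
rewrite preimage_setT probability_setT mul1e mule1 => indE.
rewrite [X in _ = (_ * X)%E]muleC -indE.
congr (Q _); apply/seteqP; split => w.
  move=> [Aw [Bw Dw]] i _.
  by case: i => -[|[|[|[|//]]]] ?; rewrite /= (tnth_nth setT) (tnth_nth X1).
move=> Cw; have in4 (i : 'I_4) : C i (tnth [tuple X1; X2; X3; X4] i w).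
  by apply: Cw; rewrite /= inE.
split; first exact: (in4 (@Ordinal 4 0 isT)).
by split; [exact: (in4 (@Ordinal 4 3 isT))|exact: (in4 (@Ordinal 4 1 isT))].
Qed.

Section joint_law.
Context {R : realType} d (T : measurableType d).

Lemma joint_law (m : {measure set T -> \bar R})
    (m1 m2 : {sigma_finite_measure set R -> \bar R}) (X Z : {mfun T >-> R}) :
  (forall A B : set R, measurable A -> measurable B ->
    m (X @^-1` A `&` Z @^-1` B) = (m1 A * m2 B)%E) ->
  forall C : set (R * R), measurable C ->
    m ((fun w => (X w, Z w)) @^-1` C) = (m1 \x m2)%E C.
Proof.
move=> mXZ C mC.
have mpair : measurable_fun [set: T] (fun w => (X w, Z w)).
  exact: measurable_fun_pair.
pose XZ : {mfun T >-> (R * R)%type} := mfun_Sub (mem_set mpair).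
by rewrite (@product_measure_unique _ _ _ _ _ m1 m2 (pushforward m XZ)).
Qed.

Lemma indep_integral (Q : probability T R) (X Z : {RV Q >-> R}) :
  (forall A B : set R, measurable A -> measurable B ->
    Q (X @^-1` A `&` Z @^-1` B) = (Q (X @^-1` A) * Q (Z @^-1` B))%E) ->
  forall f : R * R -> \bar R, measurable_fun [set: R * R] f ->
    (forall p, 0 <= f p)%E ->
  (\int[Q]_w f (X w, Z w) =
   \int[distribution Q X]_x \int[distribution Q Z]_z f (x, z))%E.
Proof.
move=> QXZ f mf f0.
have mpair : measurable_fun [set: T] (fun w => (X w, Z w)).
  exact: measurable_fun_pair.
pose XZ : {mfun T >-> (R * R)%type} := mfun_Sub (mem_set mpair).
rewrite -[LHS](@ge0_integral_distribution _ _ _ _ _ Q XZ f)//.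
rewrite (@eq_measure_integral _ _ _ _ (distribution Q X \x distribution Q Z)%E).
  by rewrite fubini_tonelli1.
by move=> C mC _; exact: (joint_law (m1 := distribution Q X)
  (m2 := distribution Q Z) QXZ mC).
Qed.

End joint_law.

Section independent_triple.
Context {R : realType} d (T : measurableType d) (Q : probability T R).
Variables V X Z : {RV Q >-> R}.
Hypothesis VXZ : forall A B D : set R,
  measurable A -> measurable B -> measurable D ->
  Q (V @^-1` A `&` (X @^-1` B `&` Z @^-1` D)) =
  (Q (V @^-1` A) * (Q (X @^-1` B) * Q (Z @^-1` D)))%E.

Lemma indep_last_two (B D : set R) : measurable B -> measurable D ->
  Q (X @^-1` B `&` Z @^-1` D) = (Q (X @^-1` B) * Q (Z @^-1` D))%E.
Proof.
move=> mB mD; have := VXZ measurableT mB mD.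
by rewrite preimage_setT setTI probability_setT mul1e.
Qed.

(** The hypothesis only concerns rectangles.  Conditioning on the event
[V @^-1` A] when it has positive probability gives a measure under which the law
of the pair [(X, Z)] is the same product of laws, by uniqueness of product
measures. *)
Lemma indep_pair (A : set R) (C : set (R * R)) : measurable A -> measurable C ->
  Q (V @^-1` A `&` (fun w => (X w, Z w)) @^-1` C) =
  (Q (V @^-1` A) * Q ((fun w => (X w, Z w)) @^-1` C))%E.
Proof.
move=> mA mC.
have mVA : measurable (V @^-1` A).
  by rewrite -[X in measurable X]setTI; exact: measurable_funP.
have mXZC : measurable ((fun w => (X w, Z w)) @^-1` C).
  by rewrite -[X in measurable X]setTI; apply: measurable_fun_pair.
have [QA0|QA0] := eqVneq (Q (V @^-1` A)) 0%E.
  rewrite QA0 mul0e; apply/eqP; rewrite -measure_le0 -QA0.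
  by apply: le_measure; rewrite ?inE//; exact: measurableI.
pose q := fine (Q (V @^-1` A)).
have QAE : Q (V @^-1` A) = q%:E by rewrite fineK// fin_num_measure.
have q0 : q != 0 by rewrite -eqe -QAE.
have q'0 : 0 <= q^-1 by rewrite invr_ge0 fine_ge0.
pose m : {measure set T -> \bar R} := mscale (NngNum q'0) (mrestr Q mVA).
have mE (E : set T) : m E = (q^-1%:E * Q (E `&` V @^-1` A))%E by [].
have : m ((fun w => (X w, Z w)) @^-1` C) = Q ((fun w => (X w, Z w)) @^-1` C).
  rewrite (joint_law (m1 := distribution Q X)
    (m2 := distribution Q Z))//; last first.
    move=> B D mB mD; rewrite mE setIC VXZ// QAE.
    by rewrite muleA -EFinM mulVf// mul1e.
  by rewrite (joint_law (m := Q) (m1 := distribution Q X)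
    (m2 := distribution Q Z) indep_last_two).
by rewrite mE setIC => <-; rewrite QAE muleA -EFinM divff// mul1e.
Qed.

End independent_triple.

Section uniform_laplace.
Context {R : realType} d (T : measurableType d) (Q : probability T R).

Lemma uniform01_ge0 (U : {RV Q >-> R}) : uniform01 U ->
  Q [set w | 0 <= U w] = 1%E.
Proof.
move=> hU.
have -> : [set w | 0 <= U w] = U @^-1` `[0%R, +oo[%classic.
  by apply/seteqP; split => w /=; rewrite in_itv/= andbT.
have := hU `[0%R, +oo[%classic; rewrite /pushforward => ->//.
rewrite /uniform_prob integral_uniform_pdf1//.
by move=> x /=; rewrite !in_itv/= => /andP[->].
Qed.

(** On [0, 1] the integrand is [r^-1] times the exponential density of rate [r],
whose integral over [0, 1] is known. *)
Lemma uniform01_laplace (U : {RV Q >-> R}) (r : R) : uniform01 U -> 0 < r ->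
  (\int[distribution Q U]_u (expR (- (r * u)))%:E =
   ((1 - expR (- r)) / r)%:E)%E.
Proof.
move=> hU r0.
have mexp : measurable_fun [set: R] (fun u : R => (expR (- (r * u)))%:E).
  exact: measurable_EFin_expR_scaled.
rewrite (ge0_integral_measurableTypeR (nu := uniform_prob (@ltr01 R)))//.
rewrite integral_uniform// subr0 invr1 mul1e.
transitivity (\int[lebesgue_measure]_(x in `[0%R, 1%R])
    (r^-1%:E * (exponential_pdf r x)%:E))%E.
  apply: eq_integral => x; rewrite inE/= in_itv/= => /andP[x0 _].
  by rewrite exponential_pdfE// -EFinM mulNr mulKf// gt_eqF.
rewrite ge0_integralZl//; last 3 first.
- by apply/measurable_EFinP/measurable_funTS; exact: measurable_exponential_pdf.
- by move=> x _; rewrite lee_fin exponential_pdf_ge0// ltW.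
- by rewrite lee_fin invr_ge0 ltW.
have := exponential_prob_itv0c r (@ltr01 R); rewrite /exponential_prob => ->.
by rewrite mulr1 -EFinB -EFinM mulrC.
Qed.

End uniform_laplace.

Section transform_sum.
Context {R : realType} d d' (T : measurableType d) (T' : measurableType d')
  (P : probability T R) (Q : probability T' R).
Variables (Y : {RV P >-> R}) (V W U : {RV Q >-> R}).
Hypothesis Ypos : P [set w | 0 < Y w] = 1%E.
Hypothesis YV : is_transform (fun y : R => y ^+ 1) Y V.
Hypothesis YW : is_transform (fun y : R => y ^+ 1) Y W.
Hypothesis hU : uniform01 U.
Hypothesis VUW : forall A B D : set R,
  measurable A -> measurable B -> measurable D ->
  Q (V @^-1` A `&` (U @^-1` B `&` W @^-1` D)) =
  (Q (V @^-1` A) * (Q (U @^-1` B) * Q (W @^-1` D)))%E.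

Let mu : probability R R := distribution P Y.

Let Z : {RV Q >-> R} := (U * W)%R.
Let S : {RV Q >-> R} := (V + U * W)%R.

Lemma transform_sum_pos : distribution Q S `]0%R, +oo[%classic = 1%E.
Proof.
have ae1 (A : {RV Q >-> R}) (B : set R) : measurable B ->
    Q (A @^-1` B) = 1%E -> {ae Q, forall w, B (A w)}.
  move=> mB QB; have mAB : measurable (A @^-1` B).
    by rewrite -[X in measurable X]setTI; exact: measurable_funP.
  exists (~` (A @^-1` B)); split => //; first exact: measurableC.
  by rewrite probability_setC// [X in (_ - X)%E]QB subee.
have Vpos := ae1 V _ (measurable_itv _) (transform_pos Ypos YV).
have Wpos := ae1 W _ (measurable_itv _) (transform_pos Ypos YW).
have Upos : {ae Q, forall w, `[0%R, +oo[%classic (U w)}.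
  apply: ae1 => //; rewrite -(uniform01_ge0 hU); congr (Q _).
  by apply/seteqP; split => w /=; rewrite in_itv/= andbT.
have : {ae Q, forall w, 0 < S w}.
  apply: filterS3 Vpos Wpos Upos => w /=; rewrite !in_itv/= !andbT => V0 W0 U0.
  by rewrite ltr_pwDl// mulr_ge0// ltW.
have mSpos : measurable (S @^-1` `]0%R, +oo[%classic).
  by rewrite -[X in measurable X]setTI; exact: measurable_funP.
move=> [N [mN QN SN]]; apply/eqP; rewrite eq_le probability_le1//=.
have QNC : Q (~` N) = 1%E.
  by rewrite probability_setC// [X in (_ - X)%E]QN sube0.
rewrite -QNC; apply: le_measure; rewrite ?inE//; first exact: measurableC.
move=> w Nw; rewrite /= in_itv/= andbT.
by apply/negP => S0; apply: Nw; apply: SN => /= /S0.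
Qed.

Let measurable_kernel (s : R) :
  measurable_fun [set: R * R]
    (fun p : R * R => (expR (- (s * (p.2 * p.1))))%:E).
Proof.
apply/measurable_EFinP; apply: measurableT_comp => //.
apply: measurableT_comp => //.
apply: measurable_funM => //; apply: measurable_funM.
  exact: measurable_snd.
exact: measurable_fst.
Qed.

(** Conditioning on [W] first: the bias of [W] by [y] cancels the denominator of
(1 - exp(-sy)) / (sy). *)
Lemma uniform_product_laplace (s : R) : 0 < s ->
  (\int[distribution Q Z]_z (expR (- (s * z)))%:E =
   ((1 - laplace mu 0 s) / (s * laplace mu 1 0))%:E)%E.
Proof.
move=> s0.
pose f (p : R * R) := (expR (- (s * (p.2 * p.1))))%:E.
have f0 p : (0 <= f p)%E by rewrite lee_fin expR_ge0.
(* The inner integral is kept as such, rather than replaced by its closed form: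
   Tonelli's theorem then provides its measurability. *)
pose F y := (\int[distribution Q U]_u f (y, u))%E.
have mF : measurable_fun [set: R] F.
  apply: (measurable_fun_fubini_tonelli_F f) => //.
  exact: measurable_kernel.
have F0 y : (0 <= F y)%E by apply: integral_ge0 => u _; exact: f0.
have FE y : 0 < y -> F y = ((1 - expR (- (s * y))) / (s * y))%:E.
  move=> y0; rewrite -(uniform01_laplace hU) ?mulr_gt0//.
  by apply: eq_integral => u _; rewrite /f/= mulrA mulrAC.
have UW (A B : set R) : measurable A -> measurable B ->
    Q (W @^-1` A `&` U @^-1` B) = (Q (W @^-1` A) * Q (U @^-1` B))%E.
  by move=> mA mB; rewrite setIC muleC; exact: (indep_last_two VUW).
have mexp : measurable_fun [set: R] (fun u : R => (expR (- (s * u)))%:E).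
  exact: measurable_EFin_expR_scaled.
rewrite ge0_integral_distribution//.
rewrite -[LHS]/(\int[Q]_w f (W w, U w))%E.
rewrite (indep_integral UW (measurable_kernel s) f0) -/F.
have -> : (\int[distribution Q W]_x F x =
    \int[distribution Q W]_x (fine (F x))%:E)%E.
  have W1 := transform_pos Ypos YW.
  rewrite (ge0_integral_pos W1 mF F0) ge0_integral_pos//.
  - by apply: eq_integral => x; rewrite inE/= in_itv/= andbT => x0; rewrite FE.
  - by apply/measurable_EFinP; apply: measurableT_comp.
  - by move=> x; rewrite lee_fin fine_ge0.
rewrite (transform_integral Ypos YW); last 2 first.
- exact: measurableT_comp.
- by move=> x; rewrite fine_ge0.
have -> : (\int[mu]_(x in `]0%R, +oo[) (x ^+ 1 * fine (F x))%:E =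
    \int[mu]_(x in `]0%R, +oo[) (s^-1 * (1 - expR (- (s * x))))%:E)%E.
  apply: eq_integral => x; rewrite inE/= in_itv/= andbT => x0.
  rewrite FE//=; congr EFin; field; by rewrite !gt_eqF.
have mu1 : mu `]0%R, +oo[%classic = 1%E := distribution_pos Ypos.
have int1 := one_minus_exp_integrable mu (ltW s0).
under eq_integral do rewrite EFinM.
rewrite integralZl// (one_minus_laplace mu1 (ltW s0)).
rewrite /Rintegral -[X in (_ * (_ * X))%E]fineK; last exact: integrable_fin_num.
by rewrite -!EFinM invfM; congr EFin; ring.
Qed.

Lemma transform_sum_laplace (s : R) : 0 < s ->
  laplace (distribution Q S) 0 s =
  laplace mu 1 s / laplace mu 1 0 *
    ((1 - laplace mu 0 s) / (s * laplace mu 1 0)).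
Proof.
move=> s0; apply: EFin_inj.
rewrite (laplace_integralT transform_sum_pos (ltW s0)).
rewrite ge0_integral_distribution//; last first.
  exact: measurable_EFin_expR_scaled.
have VZ (A B : set R) : measurable A -> measurable B ->
    Q (V @^-1` A `&` Z @^-1` B) = (Q (V @^-1` A) * Q (Z @^-1` B))%E.
  move=> mA mB.
  have mC : measurable ((fun p : R * R => p.1 * p.2) @^-1` B).
    rewrite -[X in measurable X]setTI.
    by apply: measurable_funM.
  exact: (indep_pair VUW mA mC).
pose f (p : R * R) := (expR (- (s * (p.1 + p.2))))%:E.
have mf : measurable_fun [set: R * R] f.
  apply/measurable_EFinP; apply: measurableT_comp => //.
  apply: measurableT_comp => //.
  apply: measurable_funM => //; apply: measurable_funD.
    exact: measurable_fst.
  exact: measurable_snd.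
have f0 p : (0 <= f p)%E by rewrite lee_fin expR_ge0.
rewrite -[LHS]/(\int[Q]_w f (V w, Z w))%E (indep_integral VZ mf f0).
have mexp : measurable_fun [set: R] (fun u : R => (expR (- (s * u)))%:E).
  exact: measurable_EFin_expR_scaled.
under eq_integral.
  move=> x _; rewrite /f/=.
  under eq_integral do rewrite mulrDr opprD expRD EFinM.
  rewrite ge0_integralZl//.
  rewrite uniform_product_laplace//.
  over.
have c0 : 0 <= (1 - laplace mu 0 s) / (s * laplace mu 1 0).
  have mu1 : mu `]0%R, +oo[%classic = 1%E := distribution_pos Ypos.
  rewrite divr_ge0 ?mulr_ge0 ?(ltW s0)// ?laplace_ge0// subr_ge0.
  by rewrite ltW// laplace_lt1.
rewrite ge0_integralZr//.
rewrite -(laplace_integralT (transform_pos Ypos YV) (ltW s0)).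
by rewrite -EFinM (laplace_transform Ypos YV (ltW s0)).
Qed.

End transform_sum.

(** * The characterization *)

Theorem lemma1p3 (R : realType)
  (d : measure_display) (T : measurableType d) (P : probability T R)
  (Y : {RV P >-> R})
  (hYpos : P [set w | (0 < Y w)%R] = 1%E)
  (hY2 : ('E_P[(fun w => Y w ^+ 2)%R] < +oo)%E)
  (d' : measure_display) (T' : measurableType d') (Q : probability T' R)
  (Yd Yd' Ydd U : {RV Q >-> R})
  (hYd : is_transform (fun y : R => y) Y Yd)
  (hYd' : is_transform (fun y : R => y) Y Yd')
  (hYdd : is_transform (fun y : R => y ^+ 2) Y Ydd)
  (hU : uniform01 U)
  (hind : mutually_independent (tnth [tuple Yd; Yd'; Ydd; U])) :
  exponentially_distributed Y <->
  eq_in_distribution Q Ydd Q (fun w => Yd w + U w * Yd' w).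
Proof.
pose mu : probability R R := distribution P Y.
pose S : {RV Q >-> R} := (Yd + U * Yd')%R.
have mu_pos : mu `]0%R, +oo[%classic = 1%E := distribution_pos hYpos.
have mom1 : moment_finite mu 1 := transform_moment_finite (k := 1) hYpos hYd.
have mom2 : moment_finite mu 2 := transform_moment_finite hYpos hYdd.
have VUW := mutually_independent_triple hind.
have S_pos := transform_sum_pos (Y := Y) hYpos hYd hYd' hU.
have Ydd_pos := transform_pos hYpos hYdd.
have S_laplace s (s0 : 0 < s) := transform_sum_laplace hYpos hYd hYd' hU VUW s0.
have Ydd_laplace s (s0 : 0 < s) := laplace_transform hYpos hYdd (ltW s0).
split.
  move=> [m m0 hexp]; have K0 : 0 < m^-1 by rewrite invr_gt0.
  have muE : has_law mu idfun (exponential_prob m^-1) by [].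
  move=> B mB; apply: (laplace_unique Ydd_pos S_pos) => // s s0.
  rewrite Ydd_laplace//; apply: etrans (esym (S_laplace s s0)); rewrite -/mu.
  rewrite (laplace_exponential K0 (ltW s0) muE).
  rewrite !(laplace1_exponential K0 muE)// ?ltW//.
  rewrite !(laplace2_exponential K0 muE)// ?ltW//.
  have Ks : m^-1 + s != 0 by rewrite gt_eqF// addr_gt0.
  rewrite !addr0; set K := m^-1 in K0 Ks *.
  by field; rewrite Ks !gt_eqF.
move=> SE.
have [K K0 phiE] : exists2 K, 0 < K &
    forall s, 0 < s -> laplace mu 0 s = K / (K + s).
  pose m := laplace mu 1 0; pose M := laplace mu 2 0.
  have m0 : 0 < m by exact: laplace_gt0.
  have M0 : 0 < M by exact: laplace_gt0.
  apply: (@laplace_ode _ _ (laplace mu 1) (laplace mu 2) (M / m ^+ 2) m).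
  - by move=> s; exact: (laplace_derive (moment_finite0 mu)).
  - by move=> s; exact: laplace_derive.
  - move=> s s0; rewrite laplace_gt0 ?laplace_lt1 ?ltW//.
    exact: moment_finite0.
  - rewrite -(laplace00 mu_pos); apply: laplace_cvg0; exact: moment_finite0.
  - exact: laplace_cvg0.
  - exact: laplace_cvgy.
  - move=> s s0; have := S_laplace s s0.
    have -> : laplace (distribution Q S) 0 s = laplace mu 2 s / M.
      rewrite -Ydd_laplace//; congr fine.
      apply: eq_measure_integral => B mB _; exact/esym/SE.
    rewrite -/mu -/m => e.
    have -> : laplace mu 2 s = laplace mu 2 s / M * M by rewrite divfK// gt_eqF.
    by rewrite e; field; rewrite !gt_eqF.
exists K^-1; rewrite ?invr_gt0// invrK.
have [E EE] := exponential_probability K0.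
have E_pos : E `]0%R, +oo[%classic = 1%E.
  by have := EE `]0%R, +oo[%classic; rewrite exponential_prob_pos//; apply.
move=> B mB; rewrite -(EE B mB).
apply: (laplace_unique mu_pos E_pos) => // s s0.
by rewrite phiE// (laplace_exponential K0 (ltW s0) EE).
Qed.
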